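(* Let $\Gamma$ be an Abelian group with $|\Gamma|\ge 3$ and let $G$ be an $r$-regular graph with vertices $v_1,\dots,v_n$. Let $g,g_1\in\Gamma$, and let $H_1,\dots,H_n$ be graphs such that each $H_i$ has a $\Gamma$-vertex magic labeling $\ell_i$ with magic constant $g_1$ and $\sum_{x\in V(H_i)}\ell_i(x)=g$. Then $G[H_1,H_2,\dots,H_n]$ is $\Gamma$-vertex magic.
   Context: Graphs are finite, simple and undirected. For an additive Abelian group $\Gamma$ with identity $0$ and a graph $G$, a $\Gamma$-vertex magic labeling is a map $\ell:V(G)\to\Gamma\setminus\{0\}$ for which there is $\mu\in\Gamma$ (the magic constant) with $w(v)=\sum_{u\in N(v)}\ell(u)=\mu$ for every vertex $v$; $G$ is $\Gamma$-vertex magic if it has such a labeling. The generalized composition $G[H_1,\dots,H_n]$ has vertex set $\{(v_i,h): 1\le i\le n,\ h\in V(H_i)\}$, with $(v_i,h)\sim(v_j,h')$ iff $v_i\sim v_j$ in $G$, or $i=j$ and $h\sim h'$ in $H_i$. *)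

(* Defs.v *)
From HB Require Import structures.
From mathcomp Require Import all_boot all_order all_algebra.

Set Implicit Arguments.
Unset Strict Implicit.
Unset Printing Implicit Defensive.

Import GRing.Theory.
Local Open Scope ring_scope.

Record sgraph := SGraph {
  vertex :> finType;
  adj : rel vertex;
  adj_sym : symmetric adj;
  adj_irrefl : irreflexive adj
}.

Definition regular (G : sgraph) (r : nat) : Prop :=
  forall x : G, #|[set y | adj x y]| = r.

Definition weight (Gamma : zmodType) (G : sgraph) (l : G -> Gamma) (x : G) :=
  \sum_(y : G | adj x y) l y.

Definition magic_labeling (Gamma : zmodType) (G : sgraph) (l : G -> Gamma)
    (mu : Gamma) : Prop :=
  (forall x, l x != 0) /\ (forall x, weight l x = mu).

Definition vertex_magic (Gamma : zmodType) (G : sgraph) : Prop :=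
  exists (l : G -> Gamma) (mu : Gamma), magic_labeling l mu.

Section GeneralizedComposition.

Variables (G : sgraph) (n : nat) (v : 'I_n -> G) (H : 'I_n -> sgraph).

(* The pair (v_i, h) is encoded as Tagged H h with tag i, so this is the vertex
   set of G[H_1, ..., H_n] when v enumerates the vertices of G bijectively. *)
Definition gcomp_vertex : finType := {i : 'I_n & H i}.

Definition gcomp_adj : rel gcomp_vertex := fun x y =>
  adj (v (tag x)) (v (tag y))
  || (tag x == tag y) && adj (tagged x) (tagged_as x y).

Lemma gcomp_adjP (x y : gcomp_vertex) :
  reflect (adj (v (tag x)) (v (tag y)) \/
           exists (i : 'I_n) (h h' : H i),
             [/\ x = Tagged H h, y = Tagged H h' & adj h h'])
          (gcomp_adj x y).
Proof.
rewrite /gcomp_adj; apply: (iffP orP) => -[]; try by left.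
  case: x y => [i h] [j h'] /= /andP[/eqP eij]; case: j / eij h' => h'.
  by rewrite tagged_asE => hh'; right; exists i, h, h'.
by case=> i [h [h' [-> -> hh']]]; right; rewrite eqxx tagged_asE.
Qed.

Lemma gcomp_adj_sym : symmetric gcomp_adj.
Proof.
suff S x y : gcomp_adj x y -> gcomp_adj y x by move=> x y; apply/idP/idP; apply: S.
move=> /gcomp_adjP[xy|[i [h [h' [-> -> hh']]]]]; apply/gcomp_adjP.
  by left; rewrite adj_sym.
by right; exists i, h', h; rewrite adj_sym.
Qed.

Lemma gcomp_adj_irrefl : irreflexive gcomp_adj.
Proof. by case=> i h; rewrite /gcomp_adj tagged_asE !adj_irrefl andbF. Qed.

Definition gcomp : sgraph := SGraph gcomp_adj_sym gcomp_adj_irrefl.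

End GeneralizedComposition.

(* Main.v *)
(* If each [l i] labels [H i], label [(v_i, h)] by [l i h].  A neighbour of
   [(v_i, h)] lies either in [H i], where the labels contribute [g1], or in one
   of the [r] full copies [H j] with [v_j] adjacent to [v_i], each contributing
   [g]; so every weight is [g1 + r g]. *)

Require Import Defs.
From mathcomp Require Import all_boot all_order all_algebra.

Set Implicit Arguments.
Unset Strict Implicit.
Unset Printing Implicit Defensive.

Import GRing.Theory.
Local Open Scope ring_scope.

(** Split the sum over the composition by tag and compare it with the right-hand side copy by
    copy. *)
Lemma weight_gcomp (Gamma : zmodType) (G : sgraph) (n : nat) (v : 'I_n -> G)
    (H : 'I_n -> sgraph) (l : forall i, H i -> Gamma) (i : 'I_n) (h : H i) :
  weight (fun y : gcomp v H => l (tag y) (tagged y)) (Tagged H h) =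
  weight (@l i) h + \sum_(j | adj (v i) (v j)) \sum_(x : H j) l j x.
Proof.
rewrite /weight.
have -> : \sum_(y : gcomp v H | adj (Tagged H h : gcomp v H) y)
    l (tag y) (tagged y) =
  \sum_j \sum_(x : H j | gcomp_adj v (Tagged H h) (Tagged H x)) l j x.
  by rewrite sig_big_dep; apply: eq_big => [[j x]|].
(* In the copy [i], only edges of [H i] count, since [v i] is not adjacent to itself. *)
rewrite (bigD1 i) //=; congr (_ + _).
  by apply: eq_bigl => x; rewrite /gcomp_adj /= adj_irrefl eqxx tagged_asE.
(* For the same reason the term [j = i] on the right is zero, so both sums now run over [j != i]. *)
rewrite [RHS]big_mkcond [RHS](bigD1 i) //= adj_irrefl add0r.
apply: eq_bigr => j neq_ji.
(* Adjacency to another copy does not depend on [x]: it is all or nothing. *)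
have adjE x : gcomp_adj v (Tagged H h) (Tagged H (x : H j)) =
    adj (v i) (v j).
  by rewrite /gcomp_adj /= eq_sym (negPf neq_ji) orbF.
by rewrite (eq_bigl _ _ adjE) big_mkcond; case: ifP => // _; rewrite big1.
Qed.

(** Reindexing along [v] carries the degree from vertices over to indices. *)
Lemma card_adj_enum (G : sgraph) (r n : nat) (v : 'I_n -> G) (i : 'I_n) :
  regular G r -> bijective v -> #|[pred j | adj (v i) (v j)]| = r.
Proof.
move=> hG hv; rewrite -(hG (v i)) -!sum1_card.
rewrite [RHS](reindex v) /=; last exact: onW_bij.
by apply: eq_bigl => j; rewrite inE.
Qed.

Theorem theorem3p9 (Gamma : zmodType)
    (hGamma : exists a b c : Gamma, uniq [:: a; b; c])
    (r n : nat) (G : sgraph) (hG : regular G r)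
    (v : 'I_n -> G) (hv : bijective v)
    (g g1 : Gamma) (H : 'I_n -> sgraph)
    (hH : forall i : 'I_n, exists l : H i -> Gamma,
        magic_labeling l g1 /\ \sum_(x : H i) l x = g) :
  vertex_magic Gamma (gcomp v H).
Proof.
(* Finite choice over ['I_n] picks all the labelings at once. *)
have [l hl] := fin_all_exists hH.
exists (fun y : gcomp v H => l (tag y) (tagged y)), (g1 + g *+ r).
split=> [[i h]|[i h]]; first by have [[l_neq0 _] _] := hl i; apply: l_neq0.
have [[_ wl] _] := hl i.
rewrite weight_gcomp wl; congr (_ + _).
under eq_bigr => j _ do rewrite (hl j).2.
by rewrite sumr_const (card_adj_enum i hG hv).
Qed.
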